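(* For a locally compact metric space $(X,d)$, let $\Sigma(X)$ denote the space of connected components of $X$ and $I(X,d)$ its group of isometries. \begin{enumerate} \item If $\Sigma(X)$ is not compact, $I(X,d)$ need not be locally compact, nor act properly on $X$; that is, there exists a locally compact metric space $(X,d)$ with $\Sigma(X)$ not compact such that $I(X,d)$ is not locally compact and the action $(I(X,d),X)$ is not proper. \item If $\Sigma(X)$ is compact, then: \begin{itemize} \item[(a)] $I(X,d)$ is locally compact (for every locally compact metric space $(X,d)$ with $\Sigma(X)$ compact); \item[(b)] the action $(I(X,d),X)$ is not always proper; that is, there exists a locally compact metric space $(X,d)$ with $\Sigma(X)$ compact such that the action $(I(X,d),X)$ is not proper; \item[(c)] in the special case where $X$ is connected, the action $(I(X,d),X)$ is proper (for every connected locally compact metric space $(X,d)$). \end{itemize} \end{enumerate}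
   Context: An isometry of $(X,d)$ is a surjective distance-preserving map $X\to X$; $I(X,d)$ is the group of all isometries of $(X,d)$ under composition, endowed with the topology of pointwise convergence (the subspace topology from the space $C(X,X)$ of continuous maps $X\to X$ with the pointwise convergence topology). A subbasis of neighborhoods of the identity is given by the sets $\{g\in I(X,d): gx\in V_x\}$, where $x\in X$ and $V_x$ is a neighborhood of $x$. $\Sigma(X)$ is the set of connected components of $X$ with the quotient topology via the natural map $q:X\to\Sigma(X)$ sending each point to its connected component; it need not be Hausdorff, and ''compact'' for $\Sigma(X)$ means that every open cover has a finite subcover. The action $(I(X,d),X)$ is the natural action $(g,x)\mapsto gx=g(x)$. A set is relatively compact if its closure is compact. The action of $G=I(X,d)$ on $X$ is proper if for every $x,y\in X$ there are neighborhoods $U_x$ of $x$ and $U_y$ of $y$ such that $(U_x,U_y):=\{g\in G: (gU_x)\cap U_y\neq\emptyset\}$ is relatively compact in $G$. *)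

(* Defs.v *)
From HB Require Import structures.
From mathcomp Require Import all_boot all_order all_algebra.
From mathcomp Require Import all_classical all_reals all_analysis.

Set Implicit Arguments.
Unset Strict Implicit.
Unset Printing Implicit Defensive.

Import Order.TTheory GRing.Theory Num.Theory.

Local Open Scope classical_set_scope.
Local Open Scope ring_scope.
Local Open Scope quotient_scope.

Section components.
Context {R : realType} (X : metricType R).

Definition same_component (x y : X) : bool :=
  `[< connected_component [set: X] x y >].

Lemma same_component_refl : reflexive same_component.
Proof. by move=> x; apply/asboolP; exact: connected_component_refl. Qed.

Lemma same_component_sym : symmetric same_component.
Proof.
by move=> x y; apply/asboolP/asboolP; exact: connected_component_sym.
Qed.

Lemma same_component_trans : transitive same_component.
Proof.
move=> y x z /asboolP xy /asboolP yz; apply/asboolP.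
exact: connected_component_trans yz.
Qed.

Canonical same_component_equiv := EquivRel same_component
  same_component_refl same_component_sym same_component_trans.

(* Sigma(X); the map q : X -> Sigma(X) is [\pi_component_space]. *)
Definition component_space : topologicalType :=
  quotient_topology {eq_quot same_component_equiv}.

End components.

Section isometries.
Context {R : realType} (X : metricType R).

(* Gives [continuousType X X] the topology of pointwise convergence. *)
Import ArrowAsProduct.

Definition isometries : set (continuousType X X) :=
  [set g | (forall x y : X, mdist (g x) (g y) = mdist x y) /\
           (forall y : X, exists x : X, g x = y)].

(* The space I(X,d), a subspace of C(X,X); the composition law plays no role in
   local compactness or properness and is not registered. *)
Definition isometry_group : topologicalType := set_type isometries.

Definition isometry_act (g : isometry_group) (x : X) : X :=
  (set_val g : continuousType X X) x.

(* (U, V) = {g | gU meets V}. *)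
Definition transporter (U V : set X) : set isometry_group :=
  [set g | (isometry_act g @` U) `&` V !=set0].

Definition isometry_action_proper : Prop :=
  forall x y : X, exists U V : set X,
    [/\ nbhs x U, nbhs y V & compact (closure (transporter U V))].

End isometries.

(* Main.v *)
Require Import Defs.
From HB Require Import structures.
From mathcomp Require Import all_boot all_order all_algebra.
From mathcomp Require Import all_classical all_reals all_analysis.
From mathcomp Require Import finmap lra.

(** Call [x] and [y] linked when they are joined by a chain of steps, each
    shorter than a third of the radius of a relatively compact ball around its
    starting point. The linked classes are clopen and invariant under
    isometries. If an ultrafilter of isometries converges at [x], then it
    converges on the whole class of [x]. When there are finitely many classes,
    in particular when the space of components is compact, convergence at one
    representative of each class therefore gives a pointwise limit, and the same
    argument applied to the inverses shows that this limit is surjective. So a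
    set of isometries which maps each representative into a given compact set is
    relatively compact: this yields local compactness, and properness when there
    is a single class.

    The counterexamples are an infinite discrete space with the 0-1 metric, and
    the line with the metric [min 1 |a - b|] to which a point at distance 1 from
    everything is added: translations of the line fix that point. *)

Set Implicit Arguments.
Unset Strict Implicit.
Unset Printing Implicit Defensive.

Import Order.TTheory GRing.Theory Num.Theory.
Import numFieldNormedType.Exports.

Local Open Scope classical_set_scope.
Local Open Scope ring_scope.

(** * Filters in initial topologies, and ultrafilters *)

Lemma initial_cvg (S : choiceType) (T : topologicalType) (f : S -> T)
    (F : set_system S) (s : S) : Filter F ->
  f @ F --> f s -> F --> (s : initial_topology f).
Proof.
move=> FF Ffs A [_ [[B oB <-] Bs sBA]].
by apply: filterS sBA _; apply: Ffs; exact: open_nbhs_nbhs.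
Qed.

Lemma ultra_fmap (T U : Type) (f : T -> U) (F : set_system T) :
  UltraFilter F -> UltraFilter (f @ F).
Proof.
move=> FU; apply: Build_UltraFilter => G GP sFG.
apply/seteqP; split=> // A GA.
have [//|FnA] := in_ultra_setVsetC (f @^-1` A) FU.
have /filterI/(_ GA) : G (~` A) by exact: sFG.
by rewrite setICl => /filter_ex[].
Qed.

Lemma compact_ultra_cvg (T : Type) (U : topologicalType) (f : T -> U)
    (K : set U) (F : set_system T) :
  UltraFilter F -> compact K -> (\forall t \near F, K (f t)) ->
  exists2 p, K p & f @ F --> p.
Proof.
move=> FU; rewrite compact_ultra => cK FK.
by have [p [Kp fp]] := cK _ (ultra_fmap f FU) FK; exists p.
Qed.

(** Otherwise every complement belongs to [F], and so does their finite intersection, which misses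
    the union. *)
Lemma ultra_bigcup_fset (T : Type) (I : choiceType) (D : {fset I})
    (A : I -> set T) (F : set_system T) :
  UltraFilter F -> F (\bigcup_(i in [set` D]) A i) ->
  exists2 i, i \in D & F (A i).
Proof.
move=> FU FA; apply: contrapT => nA.
have /filterI/(_ FA)/filter_ex[t [ht [i Di Ait]]] :
    F (\bigcap_(i in [set` D]) ~` A i).
  apply: filter_bigI => i Di.
  have [FAi|//] := in_ultra_setVsetC (A i) FU.
  by exfalso; apply: nA; exists i.
exact: ht Ait.
Qed.

(** * Isometries: inverses, evaluation maps and pointwise convergence *)

Section isometries.
Context {R : realType} (X : metricType R).
Implicit Types (g h : isometry_group X) (x y z : X).

Lemma isometry_actP g :
  (forall x y, mdist (isometry_act g x) (isometry_act g y) = mdist x y) /\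
  (forall y, exists x, isometry_act g x = y).
Proof. exact: (set_valP g). Qed.

Lemma mdist_act g x y : mdist (isometry_act g x) (isometry_act g y) = mdist x y.
Proof. exact: (isometry_actP g).1. Qed.

Lemma act_continuous g : continuous (isometry_act g).
Proof. exact: cts_fun. Qed.

Lemma isometry_ex (f : X -> X) :
  (forall x y, mdist (f x) (f y) = mdist x y) ->
  (forall y, exists x, f x = y) ->
  exists g, isometry_act g = f.
Proof.
move=> fd fs.
have cf : continuous f.
  move=> x; apply/metricType_numDomainType.cvgrPdist_lt => e e0.
  apply/metricType_numDomainType.nbhs_mdistP.
  by exists e => //= y; rewrite /= fd.
pose f' : continuousType X X := mkcts cf.
have f'I : f' \in isometries (X:=X) by apply: mem_set; split.
by exists (SigSub f'I).
Qed.

(** Preserving distances forces injectivity, so a right inverse chosen by surjectivity is two-sided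
    and again an isometry. *)
Lemma isometry_inv_ex : exists inv : isometry_group X -> isometry_group X,
  (forall g, cancel (isometry_act g) (isometry_act (inv g))) /\
  (forall g, cancel (isometry_act (inv g)) (isometry_act g)).
Proof.
have inv_ex g : exists g', cancel (isometry_act g) (isometry_act g') /\
    cancel (isometry_act g') (isometry_act g).
  have [f fK] := choice (isometry_actP g).2.
  have Kf : cancel (isometry_act g) f.
    by move=> x; apply: mdist_positivity; rewrite -(mdist_act g) fK mdistxx.
  have [x y|y|g' g'E] := @isometry_ex f.
  - by rewrite -(mdist_act g) !fK.
  - by exists (isometry_act g y).
  - by exists g'; rewrite g'E.
have [inv invP] := choice inv_ex.
by exists inv; split=> g; have [] := invP g.
Qed.

Lemma isometry_eval_continuous x : continuous (fun g => isometry_act g x).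
Proof.
move=> g.
have e1 : continuous (set_val : isometry_group X -> _).
  exact: initial_continuous.
have e2 : continuous
    (id : initial_topology (id : continuousType X X -> {ptws X -> X}) ->
      {ptws X -> X}).
  exact: initial_continuous.
have e3 : continuous (proj x : {ptws X -> X} -> X) by exact: proj_continuous.
exact: (cvg_comp _ _ (e1 g) (cvg_comp _ _ (e2 _) (e3 _))).
Qed.

(** The topology comes in layers: it is initial for the inclusion into the continuous maps, then
    into all maps, where it is the supremum of the topologies induced by the evaluations. *)
Lemma isometry_cvg (F : set_system (isometry_group X)) g : Filter F ->
  (forall x, isometry_act g' x @[g' --> F] --> isometry_act g x) -> F --> g.
Proof.
move=> FF Fg; apply: initial_cvg; apply: initial_cvg.
apply/cvg_sup => x; apply: initial_cvg; exact: Fg.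
Qed.


(** * Metric neighborhoods, steps and linked classes *)

Lemma cvg_mdist (T : Type) (F : set_system T) (f : T -> X) p : Filter F ->
  f @ F --> p <-> forall e, 0 < e -> \forall t \near F, mdist p (f t) < e.
Proof. by move=> FF; exact: metricType_numDomainType.cvgrPdist_lt. Qed.

Lemma nbhs_mdist p (A : set X) :
  nbhs p A <-> exists2 e : R, 0 < e & forall y, mdist p y < e -> A y.
Proof.
split=> [/metricType_numDomainType.nbhs_mdistP[e /= e0 sA]|[e e0 sA]].
  by exists e.
by apply/metricType_numDomainType.nbhs_mdistP; exists e.
Qed.

(** The factor 3 is what the triangle inequality costs in [saturated_cvg]. Compactness is asked
    around [x] only, so the relation is not symmetric by definition; [saturated] handles both
    directions. *)
Definition step x y := exists e : R, mdist x y < e /\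
  exists2 K : set X, compact K & forall z, mdist x z < 3 * e -> K z.

Definition saturated (S : set X) := forall x y, step x y -> (S x <-> S y).

(* The equivalence relation generated by [step], without explicit chains. *)
Definition linked x y := forall S, saturated S -> (S x <-> S y).

Context (lcX : locally_compact [set: X]).

Lemma step_near x : exists2 e : R, 0 < e & forall y, mdist x y < e -> step x y.
Proof.
have [K + [cK _]] := lcX (I : [set: X] x).
rewrite withinET => /nbhs_mdist[e e0 sK].
exists (e / 3); first by rewrite divr_gt0.
move=> y xy; exists (e / 3); split=> //; exists K => // z xz; apply: sK.
by apply: lt_le_trans xz _; lra.
Qed.

Lemma saturated_setC S : saturated S -> saturated (~` S).
Proof. by move=> sS x y /sS xy; split=> nS /xy. Qed.

Lemma saturated_open S : saturated S -> open S.
Proof.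
move=> sS; rewrite openE => x Sx.
have [e e0 xe] := step_near x; apply/nbhs_mdist; exists e => // y /xe xy.
exact/(sS _ _ xy).
Qed.

Lemma saturated_clopen S : saturated S -> clopen S.
Proof.
move=> sS; split; first exact: saturated_open.
by rewrite -[S]setCK; apply: open_closedC; exact/saturated_open/saturated_setC.
Qed.

Lemma saturated_linked x : saturated (linked x).
Proof.
by move=> y z yz; split=> xy S sS; split=> [/(xy S sS)|]/(sS _ _ yz)//;
  move/(xy S sS).
Qed.

(** The class of [x] is clopen, so its nonempty trace on the connected set [A] is all of [A]. *)
Lemma connected_linked (A : set X) x y :
  connected A -> A x -> A y -> linked x y.
Proof.
move=> cA Ax Ay.
have [oL cL] := saturated_clopen (@saturated_linked x).
have LA : A `&` linked x = A.
  by apply: cA; [exists x; split | exists (linked x) | exists (linked x)].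
by have [] : (A `&` linked x) y by rewrite LA.
Qed.

(** * Isometries acting on linked classes, and limits of isometries *)

Lemma step_act g x y : step x y -> step (isometry_act g x) (isometry_act g y).
Proof.
move=> [e [xy [K cK sK]]]; exists e; split; first by rewrite mdist_act.
exists (isometry_act g @` K).
  apply: continuous_compact cK; apply: continuous_subspaceT.
  exact: act_continuous.
move=> z; have [w <-] := (isometry_actP g).2 z.
by rewrite mdist_act => /sK Kw; exists w.
Qed.

Lemma linked_act g x y :
  linked x y -> linked (isometry_act g x) (isometry_act g y).
Proof.
move=> xy S sS; apply: (xy (isometry_act g @^-1` S)) => z w zw.
exact/sS/step_act.
Qed.

Lemma saturated_cvg (T : Type) (F : set_system T) (f : T -> isometry_group X) :
  UltraFilter F ->
  saturated [set x | exists p : X, isometry_act (f t) x @[t --> F] --> p].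
Proof.
move=> FU x y [e [xye [K cK sK]]].
have e0 : 0 < e by apply: le_lt_trans xye; exact: mdist_ge0.
have cvgP z : (exists t0, \forall t \near F,
     mdist (isometry_act (f t0) x) (isometry_act (f t) z) < 3 * e) ->
   exists p : X, isometry_act (f t) z @[t --> F] --> p.
  move=> [t0 Ft0].
  have [||p _ zp] := @compact_ultra_cvg _ _ (fun t => isometry_act (f t) z)
      (isometry_act (f t0) @` K) F FU.
  - apply: continuous_compact cK; apply: continuous_subspaceT.
    exact: act_continuous.
  - apply: filterS Ft0 => t.
    have [w <-] := (isometry_actP (f t0)).2 (isometry_act (f t) z).
    by rewrite mdist_act => /sK Kw; exists w.
  - by exists p.
have tri := @metric_triangle R X.
(* Passing from [x] to [y] costs [e / 2 + e / 2 + e]; passing from [y] to [x] uses the step twice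
   and costs the full [3 * e]. *)
split=> -[p /cvg_mdist/(_ (e / 2))]; rewrite divr_gt0// => /(_ isT) Fp;
  apply: cvgP; have [t0 pt0] := filter_ex Fp; exists t0;
  apply: filterS Fp => t pt.
- have := tri (isometry_act (f t0) x) p (isometry_act (f t) y).
  have := tri p (isometry_act (f t) x) (isometry_act (f t) y).
  by rewrite (metric_sym _ p) mdist_act; lra.
- have := tri (isometry_act (f t0) x) (isometry_act (f t0) y)
    (isometry_act (f t) x).
  have := tri (isometry_act (f t0) y) p (isometry_act (f t) x).
  have := tri p (isometry_act (f t) y) (isometry_act (f t) x).
  by rewrite (metric_sym _ p) !mdist_act (metric_sym y x); lra.
Qed.

(** An ultrafilter on this set converges at each point of [D], hence along every linked class. The
    pointwise limit [h] preserves distances; its surjectivity is the delicate point. *)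
Lemma isometry_compact (D : {fset X}) (K : X -> set X) :
  (forall x, x \in D -> compact (K x)) ->
  (forall y, exists2 x, x \in D & linked x y) ->
  compact
    [set g : isometry_group X | forall x, x \in D -> K x (isometry_act g x)].
Proof.
move=> cK DX; rewrite compact_ultra => F FU FK.
have tri := @metric_triangle R X.
have [inv [actK invK]] := isometry_inv_ex.
have xcvg y : exists p : X, isometry_act g y @[g --> F] --> p.
  have [x xD xy] := DX y.
  apply/(xy [set y | exists p : X, isometry_act g y @[g --> F] --> p]).
    exact: saturated_cvg.
  have [|p _ xp] := @compact_ultra_cvg _ _
      (fun g => isometry_act g x) _ F FU (cK x xD).
    by apply: filterS FK => g; exact.
  by exists p.
have [h hP] := choice xcvg.
have near_h y (e : R) : 0 < e ->
    \forall g \near F, mdist (h y) (isometry_act g y) < e.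
  by move: e; apply/cvg_mdist/hP.
have hd x y : mdist (h x) (h y) = mdist x y.
  apply/eqP; rewrite eq_le; apply/andP; split; apply/ler_addgt0Pr => e e0;
    have e20 : 0 < e / 2 by [rewrite divr_gt0];
    have [g [gx gy]] := filter_ex (filterI (near_h x _ e20) (near_h y _ e20)).
  - have := tri (h x) (isometry_act g x) (h y).
    have := tri (isometry_act g x) (isometry_act g y) (h y).
    by rewrite mdist_act (metric_sym (isometry_act g y)); lra.
  - have := tri (isometry_act g x) (h x) (isometry_act g y).
    have := tri (h x) (h y) (isometry_act g y).
    by rewrite mdist_act (metric_sym _ (h x)) /=; lra.
(* Finiteness of [D] lets the ultrafilter select a single [x] whose image is linked to [y] for
   [F]-almost all [g]. *)
have hs y : exists x, h x = y.
  have [x xD Fx] : exists2 x, x \in D & F [set g | linked y (isometry_act g x)].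
    apply: ultra_bigcup_fset; apply: filterS filterT => g _.
    have [x xD xg] := DX (isometry_act (inv g) y).
    exists x => // S sS; have := linked_act g xg sS.
    by rewrite invK => ->.
  (* The complement of the class of [y] is open, so the limit [h x] cannot leave that class. *)
  have yh : linked y (h x).
    apply: contrapT => nyh.
    have /(hP x) : nbhs (h x) (~` linked y).
      apply: open_nbhs_nbhs; split=> //.
      exact/saturated_open/saturated_setC/saturated_linked.
    by move=> /filterI/(_ Fx)/filter_ex[g []].
  (* The inverses converge at [h x], with limit [x], because [inv g (h x)] is as far from [x] as
     [h x] is from [g x]. Linkage carries the convergence to [y]. *)
  have [z zP] : exists z, isometry_act (inv g) y @[g --> F] --> z.
    apply/(yh [set y | exists p : X, isometry_act (inv g) y @[g --> F] --> p]).
      exact: saturated_cvg.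
    exists x; apply/cvg_mdist => e /(near_h x); apply: filterS => g /= hx.
    by rewrite -(mdist_act g) invK metric_sym.
  exists z; apply: mdist_positivity; apply/eqP.
  rewrite eq_le mdist_ge0 andbT; apply/ler_addgt0Pr => e e0.
  have e20 : 0 < e / 2 by rewrite divr_gt0.
  have /cvg_mdist/(_ _ e20) Fz := zP.
  have [g [zg /=]] := filter_ex (filterI (near_h z _ e20) Fz).
  rewrite -(mdist_act g) invK => gz.
  by have := tri (h z) (isometry_act g z) y; lra.
have [g gE] := isometry_ex hd hs.
exists g; split; last by apply: isometry_cvg => x; rewrite gE.
move=> x xD; rewrite gE.
apply: (@closed_cvg _ _ F _ (fun g => isometry_act g x) (K x)); last exact: hP.
- by apply: compact_closed; [exact: metric_hausdorff | exact: cK].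
- by apply: filterS FK => g' /(_ x xD).
Qed.

End isometries.

Lemma isometry_eval_closed (R : realType) (X : metricType R) (D : {fset X})
    (K : X -> set X) :
  (forall x, x \in D -> closed (K x)) ->
  closed
    [set g : isometry_group X | forall x, x \in D -> K x (isometry_act g x)].
Proof.
move=> cK.
rewrite (_ : mkset _ = \bigcap_(x in [set` D])
    ((fun g : isometry_group X => isometry_act g x) @^-1` K x))//.
apply: closed_bigI => x xD; apply: preimage_closed; last exact: (cK _ xD).
by apply: in1W; exact: isometry_eval_continuous.
Qed.

(** * Properness for connected spaces, local compactness for a compact space of components *)

Section compact_components.
Context {R : realType} (X : metricType R).
Context (lcX : locally_compact [set: X]).

Lemma compact_ball x : exists2 K : set X, compact K &
  exists2 e : R, 0 < e & forall y, mdist x y < e -> K y.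
Proof.
have [K + [cK _]] := lcX (I : [set: X] x).
by rewrite withinET => /nbhs_mdist; exists K.
Qed.

(** Balls of half the radius of a relatively compact ball at [y] suffice: an isometry in their
    transporter sends [x] into [K]. Connectedness leaves one linked class, so the single
    representative [x] controls everything. *)
Lemma connected_isometry_action_proper :
  connected [set: X] -> isometry_action_proper X.
Proof.
move=> cX x y; have [K cK [e e0 sK]] := compact_ball y.
have clK : closed K by apply: compact_closed => //; exact: metric_hausdorff.
exists [set z | mdist x z < e / 2], [set z | mdist y z < e / 2].
have e20 : 0 < e / 2 by rewrite divr_gt0.
split; do ?by apply/nbhs_mdist; exists (e / 2).
pose W := [set g : isometry_group X |
  forall z, z \in [fset x]%fset -> K (isometry_act g z)].
have cW : closed W.
  exact: (@isometry_eval_closed _ _ [fset x]%fset (fun=> K)).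
apply: (@subclosed_compact _ _ W); first exact: closed_closure.
  apply: (@isometry_compact _ _ lcX [fset x]%fset (fun=> K)) => // z.
  by exists x; [rewrite inE | exact: (connected_linked lcX cX)].
rewrite ((closure_id W).1 cW); apply: closureS => g [_ [[u /= xu <-] /= yu]] z.
rewrite inE => /eqP ->; apply: sK.
have := metric_triangle y (isometry_act g u) (isometry_act g x).
by rewrite mdist_act (metric_sym u); lra.
Qed.

(** Each linked class is open and a union of components, so its image under [q] is open; a finite
    subcover of these images gives the representatives. *)
Lemma finitely_many_linked : cover_compact [set: component_space X] ->
  exists D : {fset X}, forall y, exists2 x, x \in D & linked x y.
Proof.
move=> cS.
pose q : X -> component_space X := \pi_(component_space X)%qT.
have qlinked x y z : linked x y -> q y = q z -> linked x z.
  move=> xy /eqmodP/asboolP[C [Cy _ cC] Cz].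
  have yz := connected_linked lcX cC Cy Cz.
  by move=> S sS; split=> [/(xy S sS)/(yz S sS)|/(yz S sS)/(xy S sS)].
have [x _|s _|D _ covD] := cS X setT (fun x => q @` linked x).
- suff : open (q @^-1` (q @` linked x)) by [].
  rewrite (_ : _ @^-1` _ = linked x).
    exact/(saturated_open lcX)/saturated_linked.
  apply/seteqP; split=> [z [y xy yz]|z xz]; last by exists z.
  exact: qlinked xy yz.
- exists (repr s) => //; exists (repr s) => //; exact: reprK.
- exists D => y; have [x xD [z xz zy]] := covD (q y) I.
  by exists x => //; exact: qlinked xz zy.
Qed.

Lemma isometry_group_locally_compact :
  cover_compact [set: component_space X] ->
  locally_compact [set: isometry_group X].
Proof.
move=> /finitely_many_linked[D DX] g _.
pose K x := get [set K : set X | compact K /\ nbhs (isometry_act g x) K].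
have KP x : compact (K x) /\ nbhs (isometry_act g x) (K x).
  apply: (@getPex _ [set K : set X | compact K /\ nbhs (isometry_act g x) K]).
  have [L cL [e e0 sL]] := compact_ball (isometry_act g x).
  by exists L; split => //; apply/nbhs_mdist; exists e.
rewrite withinET.
(* Only finitely many evaluations are constrained, so this is a neighborhood of [g] for pointwise
   convergence. *)
exists [set h : isometry_group X | forall x, x \in D -> K x (isometry_act h x)].
  apply: (@filter_bigI _ _ D
    (fun x => (fun h : isometry_group X => isometry_act h x) @^-1` K x)) => x _.
  by apply: isometry_eval_continuous; exact: (KP x).2.
split; first by apply: (isometry_compact lcX) => // x _; exact: (KP x).1.
apply: isometry_eval_closed => x _; apply: compact_closed (KP x).1.
exact: metric_hausdorff.
Qed.

End compact_components.

(** * Obstructions to compactness and to properness *)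

Lemma separated_not_compact (R : realType) (X : metricType R) (u : nat -> X)
    (K : set X) :
  (forall m n, (m < n)%N -> 1 <= mdist (u m) (u n)) ->
  compact K -> ~ (\forall n \near \oo, K (u n)).
Proof.
move=> usep cK Ku.
have [p [_ clp]] := cK (u @ \oo) _ Ku.
have pB : nbhs p [set z | mdist p z < 1 / 2].
  by apply/nbhs_mdist; exists (1 / 2).
have freq N : exists2 n, (N <= n)%N & mdist p (u n) < 1 / 2.
  have uN : (u @ \oo) (u @` [set n | (N <= n)%N]).
    by exists N => // n /= Nn; exists n.
  by have [_ [[n /= Nn <-] pn]] := clp _ _ uN pB; exists n.
(* Starting again from [m.+1] gives two distinct terms within [1 / 2] of the cluster point, hence
   less than 1 apart. *)
have [m _ pm] := freq 0%N; have [n mn pn] := freq m.+1.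
have := usep _ _ mn; have := metric_triangle (u m) p (u n).
by rewrite (metric_sym _ p); lra.
Qed.

(** Isometries fixing [x] lie in the transporter of any two neighborhoods of [x]. Were its closure
    compact, so would be its image under evaluation at [y], which contains a 1-separated
    sequence. *)
Lemma fixer_precompact_not_proper (R : realType) (X : metricType R) (x y : X)
    (u : nat -> isometry_group X) :
  (forall n, isometry_act (u n) x = x) ->
  (forall m n, (m < n)%N ->
    1 <= mdist (isometry_act (u m) y) (isometry_act (u n) y)) ->
  ~ isometry_action_proper X.
Proof.
move=> ux uy /(_ x x)[U [V [Ux Vx cT]]].
have cK : compact ((fun g => isometry_act g y) @` closure (transporter U V)).
  apply: continuous_compact cT; apply: continuous_subspaceT.
  exact: isometry_eval_continuous.
apply: (separated_not_compact uy cK); apply: nearW => n.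
exists (u n) => //; apply: subset_closure; exists x; split.
  by exists x; [exact: nbhs_singleton | exact: ux].
exact: nbhs_singleton.
Qed.

(** * First counterexample: the infinite discrete space *)

Definition discrete_nat (R : realType) : Type := nat.

Section discrete_nat.
Context {R : realType}.
Local Notation N := (discrete_nat R).

(** Only the choice structure is taken from [nat]; the topology is the one given by the metric
    below. *)
HB.instance Definition _ := Choice.copy N nat.

Definition discrete_mdist (m n : N) : R := (m != n)%:R.

Let discrete_mdistxx m : discrete_mdist m m = 0.
Proof. by rewrite /discrete_mdist eqxx. Qed.

Let discrete_mdist_positivity m n : discrete_mdist m n = 0 -> m = n.
Proof.
by rewrite /discrete_mdist; case: eqVneq => // _ /eqP; rewrite oner_eq0.
Qed.

Let discrete_mdist_sym m n : discrete_mdist m n = discrete_mdist n m.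
Proof. by rewrite /discrete_mdist eq_sym. Qed.

Let discrete_mdist_triangle n m p :
  discrete_mdist m p <= discrete_mdist m n + discrete_mdist n p.
Proof.
rewrite /discrete_mdist -natrD ler_nat.
by case: (eqVneq m n) => [->|_]; case: (eqVneq m p); case: (eqVneq n p).
Qed.

HB.instance Definition _ := isMetric.Build R N discrete_mdistxx
  discrete_mdist_positivity discrete_mdist_sym discrete_mdist_triangle.

Lemma discrete_nat_mdistE (m n : N) : mdist m n = (m != n)%:R :> R.
Proof. by []. Qed.

Lemma discrete_nat_open (A : set N) : open A.
Proof.
rewrite openE => n An; apply/nbhs_mdist; exists 1 => // m.
by rewrite discrete_nat_mdistE; case: eqVneq => [<-|]; rewrite ?ltxx.
Qed.

Lemma discrete_nat_locally_compact : locally_compact [set: N].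
Proof.
move=> n _; rewrite withinET; exists [set n].
  by apply: open_nbhs_nbhs; split => //; exact: discrete_nat_open.
split; first exact: compact_set1.
by rewrite -[[set n]]setCK; apply: open_closedC; exact: discrete_nat_open.
Qed.

Lemma discrete_nat_components : ~ cover_compact [set: component_space N].
Proof.
move=> cS; pose q : N -> component_space N := \pi_(component_space N)%qT.
have [n _|s _|D _ covD] := cS N setT (fun n => [set q n]).
- exact: discrete_nat_open.
- by exists (repr s) => //; exact/esym/reprK.
(* Components are singletons, so a number above all of [D] lies in no chosen member of the cover. *)
have [n nD /eqmodP/asboolP nE] := covD (q (\max_(i <- D) (i : nat)).+1) I.
have nS : n = (\max_(i <- D) (i : nat)).+1.
  have [C [Cn _ cC] Cm] := nE.
  have CE : C `&` [set n] = C.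
    apply: cC; first by exists n.
      by exists [set n] => //; exact: discrete_nat_open.
    exists [set n] => //; rewrite -[[set n]]setCK; apply: open_closedC.
    exact: discrete_nat_open.
  by move: Cn; rewrite -CE => -[_ <-].
have := leq_bigmax_seq (F := fun i : N => i : nat) (r := enum_fset D) n nD isT.
by rewrite [leqLHS]nS ltnn.
Qed.

(** The transposition of [m] and [n] works, since every bijection preserves the 0-1 metric. *)
Lemma discrete_nat_swap (m n : N) : exists g : isometry_group N,
  isometry_act g m = n /\
  forall i, i != m -> i != n -> isometry_act g i = i.
Proof.
pose f (i : N) := if i == m then n else if i == n then m else i.
have fK : involutive f.
  by move=> i; rewrite /f; case: (eqVneq i m) => [->|im];
    [case: (eqVneq n m) => [->//|]; rewrite eqxx
    |case: (eqVneq i n) => [->|/negPf->]; rewrite ?eqxx ?(negPf im)].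
have [i j|i|g gE] := @isometry_ex R N f.
- by rewrite !discrete_nat_mdistE (inj_eq (inv_inj fK)).
- by exists (f i).
by exists g; rewrite gE /f eqxx; split=> // i /negPf-> /negPf->.
Qed.

Lemma discrete_nat_not_proper : ~ isometry_action_proper N.
Proof.
(* The shift by two keeps 0 fixed while 1 is sent to pairwise distinct points. *)
have [u uP] := choice (fun n => @discrete_nat_swap (1%N : N) (n.+2 : N)).
apply: (@fixer_precompact_not_proper _ N (0%N : N) (1%N : N) u) => [n|m n mn].
  by rewrite (uP n).2.
rewrite (uP m).1 (uP n).1 discrete_nat_mdistE.
by rewrite (_ : (_ != _) = true)// eqSS eqSS neq_ltn mn.
Qed.

(** A neighborhood [K] of the identity contains all isometries fixing the points below some [n],
    among them the transpositions of [n] with any [m >= n]; evaluation at [n] then takes infinitely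
    many values on [K]. *)
Lemma discrete_nat_isometries_not_locally_compact :
  ~ locally_compact [set: isometry_group N].
Proof.
move=> lcG; have [i iE] := @isometry_ex R N id (fun _ _ => erefl)
  (fun y => ex_intro _ y erefl).
have [K + [cK _]] := lcG i I; rewrite withinET => Ki.
have [n nK] : exists n : nat, forall g : isometry_group N,
    (forall j : N, (j < n)%N -> isometry_act g j = j) -> K g.
  (* Otherwise isometries outside [K] fixing longer and longer initial segments would converge
     pointwise to the identity. *)
  apply: contrapT => nK.
  have /choice[u uP] : forall n : nat, exists g : isometry_group N,
      (forall j : N, (j < n)%N -> isometry_act g j = j) /\ ~ K g.
    move=> n; apply: contrapT => ng; apply: nK; exists n => g gj.
    by apply: contrapT => nKg; apply: ng; exists g.
  have /(_ _ Ki)[M _ uK] : u n @[n --> \oo] --> i.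
    apply: isometry_cvg => j; rewrite iE; apply: cvg_near_cst.
    by exists j.+1 => // n /= jn; rewrite (uP n).1.
  exact: (uP M).2 (uK M (leqnn M)).
have [u uP] := choice (@discrete_nat_swap (n : N)).
have cKn : compact ((fun g => isometry_act g (n : N)) @` K).
  apply: continuous_compact cK; apply: continuous_subspaceT.
  exact: isometry_eval_continuous.
apply: (@separated_not_compact _ N (fun m : nat => m : N) _ _ cKn).
  by move=> k m km; rewrite discrete_nat_mdistE neq_ltn km.
exists n => // m /= nm; exists (u (m : N)); last exact: (uP (m : N)).1.
apply: nK => j jn; apply: (uP (m : N)).2; rewrite neq_ltn ?jn//.
by rewrite (leq_trans jn nm).
Qed.

End discrete_nat.

(** * Second counterexample: the line with an isolated point [None] *)

Definition pointed_line (R : realType) : Type := option R.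

Section pointed_line.
Context {R : realType}.
Local Notation L := (pointed_line R).

HB.instance Definition _ := Choice.copy L (option R).

Definition pointed_line_mdist (x y : L) : R :=
  match x, y with
  | Some a, Some b => Num.min 1 `|a - b|
  | None, None => 0
  | _, _ => 1
  end.

Let pointed_line_mdistxx x : pointed_line_mdist x x = 0.
Proof. by case: x => //= a; rewrite subrr normr0 minEle ler10. Qed.

Let pointed_line_mdist_positivity x y : pointed_line_mdist x y = 0 -> x = y.
Proof.
case: x y => [a|] [b|] //= /eqP; rewrite ?oner_eq0//.
rewrite minEle; case: ifPn => [_|_]; first by rewrite oner_eq0.
by rewrite normr_eq0 subr_eq0 => /eqP ->.
Qed.

Let pointed_line_mdist_sym x y :
  pointed_line_mdist x y = pointed_line_mdist y x.
Proof. by case: x y => [a|] [b|] //=; rewrite distrC. Qed.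

Let pointed_line_mdist_triangle y x z :
  pointed_line_mdist x z <= pointed_line_mdist x y + pointed_line_mdist y z.
Proof.
have min1 (a : R) : 0 <= Num.min 1 `|a| <= 1.
  by rewrite le_min ler01 normr_ge0 ge_min lexx.
case: x y z => [a|] [b|] [c|] /=; rewrite ?add0r ?addr0//.
- have := ler_distD b a c; rewrite !minEle.
  have := normr_ge0 (a - b); have := normr_ge0 (b - c).
  by do !case: ifPn; rewrite -?ltNge; lra.
- by have := min1 (a - b); lra.
- by have := min1 (a - c); lra.
- by have := min1 (b - c); lra.
Qed.

HB.instance Definition _ := isMetric.Build R L pointed_line_mdistxx
  pointed_line_mdist_positivity pointed_line_mdist_sym
  pointed_line_mdist_triangle.

Lemma pointed_line_mdistE (x y : L) : mdist x y = pointed_line_mdist x y :> R.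
Proof. by []. Qed.

Lemma Some_continuous : continuous (Some : R -> L).
Proof.
move=> a; apply/cvg_mdist => e e0.
near=> b; rewrite pointed_line_mdistE /=.
rewrite gt_min; apply/orP; right; near: b.
exact: (@cvgr_dist_lt _ R^o).
Unshelve. all: end_near. Qed.

Lemma pointed_line_locally_compact : locally_compact [set: L].
Proof.
have closedP (K : set L) : compact K -> closed K.
  by apply: compact_closed; exact: metric_hausdorff.
move=> [a|] _; rewrite withinET; last first.
  exists [set None : L]; last by split; [|apply: closedP]; exact: compact_set1.
  apply/nbhs_mdist; exists 1 => // -[b|//].
  by rewrite pointed_line_mdistE /= ltxx.
(* The open unit ball around [Some a] avoids [None] and lies in the image of this segment. *)
have cK : compact ((Some : R -> L) @` `[a - 1, a + 1]%classic).
  apply: continuous_compact; last exact: segment_compact.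
  by apply: continuous_subspaceT; exact: Some_continuous.
exists ((Some : R -> L) @` `[a - 1, a + 1]%classic); last first.
  by split => //; exact: closedP.
apply/nbhs_mdist; exists 1 => // -[b|]; rewrite pointed_line_mdistE /= ?ltxx//.
rewrite gt_min ltxx /= => ab; exists b => //=; rewrite in_itv /=.
by move: ab; rewrite ltr_distlC => /andP[/ltW-> /ltW->].
Qed.

(** The image of the line is connected, so two members of the cover suffice: one for the class of
    [None], one for that of [Some 0]. *)
Lemma pointed_line_components : cover_compact [set: component_space L].
Proof.
move=> I D f _ covD.
pose q : L -> component_space L := \pi_(component_space L)%qT.
have [i Di fi] := covD (q None) Logic.I.
have [j Dj fj] := covD (q (Some 0)) Logic.I.
exists [fset i; j]%fset.
  by move=> k; rewrite !inE => /orP[] /eqP ->; apply/mem_set.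
move=> s _; rewrite -(reprK s).
case: (repr s) => [a|]; last by exists i => //=; rewrite !inE eqxx.
exists j; first by rewrite /= !inE eqxx orbT.
rewrite (_ : \pi_(component_space L)%qT (Some a) = q (Some 0))//.
apply/eqmodP/asboolP; exists (range (Some : R -> L)); last by exists 0.
split=> //.
apply: connected_continuous_connected.
  by apply/connected_intervalP.
apply: continuous_subspaceT; exact: Some_continuous.
Qed.

(** Translations by natural numbers fix [None] and move [Some 0] to points at mutual distance 1. *)
Lemma pointed_line_not_proper : ~ isometry_action_proper L.
Proof.
have tr (n : nat) : exists g : isometry_group L,
    isometry_act g None = None /\ isometry_act g (Some 0) = Some n%:R.
  have [x y|x|g gE] := @isometry_ex R L (omap (fun a => n%:R + a)).
  - case: x y => [a|] [b|] //; rewrite !pointed_line_mdistE /=.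
    by congr (Num.min 1 `|_|); rewrite opprD addrACA subrr add0r.
  - case: x => [a|]; last by exists None.
    by exists (Some (a - n%:R)); rewrite /= addrC subrK.
  - by exists g; rewrite gE /= addr0.
have [u uP] := choice tr.
apply: (@fixer_precompact_not_proper _ L None (Some 0) u) => [n|m n mn].
  exact: (uP n).1.
rewrite (uP m).2 (uP n).2 pointed_line_mdistE /= le_min lexx /=.
by rewrite distrC -natrB ?(ltnW mn)// normr_nat ler1n subn_gt0.
Qed.

End pointed_line.

Theorem mainTheorem1 (R : realType) :
  (exists X : metricType R,
     [/\ locally_compact [set: X],
         ~ cover_compact [set: component_space X],
         ~ locally_compact [set: isometry_group X]
       & ~ isometry_action_proper X])
  /\
  [/\ (forall X : metricType R,
         locally_compact [set: X] ->
         cover_compact [set: component_space X] ->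
         locally_compact [set: isometry_group X]),
      (exists X : metricType R,
         [/\ locally_compact [set: X],
             cover_compact [set: component_space X]
           & ~ isometry_action_proper X])
    & (forall X : metricType R,
         locally_compact [set: X] ->
         connected [set: X] ->
         isometry_action_proper X)].
Proof.
split.
  exists (discrete_nat R); split.
  - exact: discrete_nat_locally_compact.
  - exact: discrete_nat_components.
  - exact: discrete_nat_isometries_not_locally_compact.
  - exact: discrete_nat_not_proper.
split.
- by move=> X lcX; exact: isometry_group_locally_compact.
- exists (pointed_line R); split.
  + exact: pointed_line_locally_compact.
  + exact: pointed_line_components.
  + exact: pointed_line_not_proper.
- by move=> X lcX; exact: connected_isometry_action_proper.
Qed.
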